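(* (i) If $1\le a\le b$ and $(a,b)\ne(1,1)$, then $\mathrm{Beta}(a,b)$ satisfies the mode-median-mean inequality: its mode is at most its median, which is at most its mean. (ii) If $0<a\le b\le1$, then $\mathrm{Beta}(a,b)$ satisfies the median-mean inequality (its median is at most its mean), and, if moreover $(a,b)\neq(1,1)$, it satisfies the median-anti-mode inequality (its median is at most its anti-mode).
   Context: For $a,b>0$, $\mathrm{Beta}(a,b)$ is the distribution on $[0,1]$ with density $x^{a-1}(1-x)^{b-1}/\mathrm{B}(a,b)$ for $x\in(0,1)$, where $\mathrm{B}(a,b)=\int_0^1 y^{a-1}(1-y)^{b-1}\,dy$. The median is unique. For $a,b\ge1$ with $(a,b)\ne(1,1)$ the mode is the unique maximizer on $[0,1]$ of the density (extended continuously to $[0,1]$), namely $(a-1)/(a+b-2)$. For $0<a,b\le 1$ with $(a,b)\ne(1,1)$ the anti-mode is the unique minimizer of the density (extended continuously to those endpoints of $[0,1]$ where it has a finite limit), namely $(a-1)/(a+b-2)$. *)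

(* Defs.v *)
From HB Require Import structures.
From mathcomp Require Import all_boot all_order all_algebra.
From mathcomp Require Import all_classical all_reals all_analysis.
From mathcomp Require Import measurable_realfun lra.

Set Implicit Arguments.
Unset Strict Implicit.
Unset Printing Implicit Defensive.

Import Order.TTheory GRing.Theory Num.Theory.
Import numFieldNormedType.Exports.

Local Open Scope classical_set_scope.
Local Open Scope ring_scope.

(* The library's beta_fun, beta_pdf and beta_prob only cover parameters in nat;
   the definitions below take real parameters. *)

Section beta_density.
Context {R : realType}.
Local Notation mu := (@lebesgue_measure R).
Implicit Types a b x : R.

Definition rbeta_weight a b x : R := x `^ (a - 1) * (1 - x) `^ (b - 1).

Definition rbeta_fun a b : R := \int[mu]_(x in `]0, 1[) rbeta_weight a b x.

(* The restriction to the open interval matters: powR is total, and when a < 1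
   (resp. b < 1) its value at the endpoint is unrelated to the density. *)
Definition rbeta_pdf a b : R -> R :=
  (fun x => rbeta_weight a b x / rbeta_fun a b) \_ `]0, 1[.

Lemma rbeta_weight_ge0 a b x : 0 <= rbeta_weight a b x.
Proof. by rewrite mulr_ge0 ?powR_ge0. Qed.

Lemma measurable_rbeta_weight a b : measurable_fun setT (rbeta_weight a b).
Proof.
apply: measurable_funM.
  exact: (@measurableT_comp _ _ _ _ _ _ (@powR R ^~ (a - 1))).
apply: (@measurableT_comp _ _ _ _ _ _ (@powR R ^~ (b - 1))) => //.
exact: measurable_funB.
Qed.

Lemma rbeta_fun_ge0 a b : 0 <= rbeta_fun a b.
Proof. by apply: Rintegral_ge0 => x _; exact: rbeta_weight_ge0. Qed.

Lemma rbeta_pdf_ge0 a b x : 0 <= rbeta_pdf a b x.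
Proof.
apply: restrict_ge0 => {}x _.
by rewrite divr_ge0 ?rbeta_weight_ge0 ?rbeta_fun_ge0.
Qed.

Lemma measurable_rbeta_pdf a b : measurable_fun setT (rbeta_pdf a b).
Proof.
apply/measurable_restrict => //; apply: measurable_funTS.
by apply: measurable_funM => //; exact: measurable_rbeta_weight.
Qed.

Let continuous_pow a (l r : R) : 0 < l ->
  {within `[l, r], continuous (fun x => x `^ (a - 1))}.
Proof.
move=> l0; apply: derivable_within_continuous => x.
rewrite in_itv/= => /andP[lx _].
by apply: derivable_powR; rewrite in_itv/= andbT (lt_le_trans l0).
Qed.

Let integral_pow_le a (l : R) : 0 < a -> 0 < l < 1 ->
  (\int[mu]_(x in `[l, 1%R]) (x `^ (a - 1))%:E <= (a^-1)%:E)%E.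
Proof.
move=> a0 /andP[l0 l1].
have dF x : 0 < x -> is_derive x 1 (fun y => a^-1 * y `^ a) (x `^ (a - 1)).
  move=> x0; have := is_derive1_powR a x0 => ?.
  apply: is_derive_eq.
  by rewrite -[LHS]/(a^-1 * (a * x `^ (a - 1))) mulKf ?gt_eqF.
have cF x : 0 < x -> {for x, continuous (fun y => a^-1 * y `^ a)}.
  move=> x0; apply: differentiable_continuous; apply/derivable1_diffP.
  by have [] := dF x x0.
rewrite (@continuous_FTC2 _ _ (fun x => a^-1 * x `^ a))//.
- rewrite powR1 mulr1 -EFinB lee_fin gerBl mulr_ge0// ?powR_ge0// invr_ge0 ltW//.
- exact: continuous_pow.
- split.
  + move=> x; rewrite in_itv/= => /andP[lx _].
    by have [] := dF x (lt_trans l0 lx).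
  + by apply: cvg_at_right_filter; apply: cF.
  + by apply: cvg_at_left_filter; apply: cF.
- move=> x; rewrite in_itv/= => /andP[lx _].
  by rewrite derive1E; have [_ ->] := dF x (lt_trans l0 lx).
Qed.

Let e_ (n : nat) : R := n.+2%:R^-1.

Let e_gt0 n : 0 < e_ n. Proof. by rewrite invr_gt0. Qed.

Let e_lt1 n : e_ n < 1. Proof. by rewrite invf_lt1 ?ltr1n. Qed.

Let e_nincr : {homo e_ : m n / (m <= n)%N >-> n <= m}.
Proof. by move=> m n mn; rewrite lef_pV2 ?posrE// ler_nat. Qed.

Let e_small x : 0 < x -> exists n, e_ n <= x.
Proof.
move=> x0; exists (Num.trunc x^-1); rewrite invf_ple ?posrE//.
by rewrite ltW// (lt_le_trans (truncnS_gt _))// ler_nat.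
Qed.

Let integral_powl_lty a : 0 < a ->
  (\int[mu]_(x in `]0%R, 1%R[) (x `^ (a - 1))%:E < +oo)%E.
Proof.
move=> a0; have mp : measurable_fun setT (EFin \o (fun x => x `^ (a - 1))).
  by apply/measurable_EFinP; exact: measurable_powR.
have p0 x : (0 <= (x `^ (a - 1))%:E)%E by rewrite lee_fin powR_ge0.
pose I n : set R := `[e_ n, 1]%classic.
apply: (@le_lt_trans _ _ (\int[mu]_(x in \bigcup_n I n) (x `^ (a - 1))%:E)%E).
  apply: ge0_subset_integral => //=.
  - by apply: bigcup_measurable => n _; exact: measurable_itv.
  - exact: measurable_funTS.
  - move=> x /=; rewrite in_itv/= => /andP[x0 x1].
    have [n nx] := e_small x0.
    by exists n => //; rewrite /I/= in_itv/= nx ltW.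
apply: (@le_lt_trans _ _ (a^-1)%:E); last exact: ltry.
rewrite -(cvg_lim _ (@ge0_nondecreasing_set_cvg_integral _
  (measurableTypeR R) R I
  (fun x => (x `^ (a - 1))%:E) mu _ _ _ _))//; last 3 first.
- move=> m n mn; apply/subsetPset; apply: subset_itvr.
  by rewrite bnd_simp e_nincr.
- by move=> n; exact: measurable_itv.
- by move=> n; exact: measurable_funTS.
apply: lime_le; last first.
  by apply: nearW => n; apply: integral_pow_le; rewrite ?e_gt0 ?e_lt1.
apply: ereal_nondecreasing_is_cvgn => m n mn.
apply: ge0_subset_integral => //=.
- exact: measurable_itv.
- exact: measurable_itv.
- exact: measurable_funTS.
- by apply: subset_itvr; rewrite bnd_simp e_nincr.
Qed.

Let integral_powr_lty b : 0 < b ->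
  (\int[mu]_(x in `]0%R, 1%R[) ((1 - x) `^ (b - 1))%:E < +oo)%E.
Proof.
move=> b0; have mp : measurable_fun setT
    (EFin \o (fun x : R => (1 - x) `^ (b - 1))).
  apply/measurable_EFinP.
  apply: (@measurableT_comp _ _ _ _ _ _ (@powR R ^~ (b - 1))) => //.
  exact: measurable_funB.
have p0 (x : R) : (0 <= ((1 - x) `^ (b - 1))%:E)%E by rewrite lee_fin powR_ge0.
pose I n : set R := `[0, 1 - e_ n]%classic.
have ndI m n : (m <= n)%N -> I m `<=` I n.
  by move=> mn; apply: subset_itvl; rewrite bnd_simp lerB ?e_nincr.
apply: (@le_lt_trans _ _
    (\int[mu]_(x in \bigcup_n I n) ((1 - x) `^ (b - 1))%:E)%E).
  apply: ge0_subset_integral => //=.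
  - by apply: bigcup_measurable => n _; exact: measurable_itv.
  - exact: measurable_funTS.
  - move=> x /=; rewrite in_itv/= => /andP[x0 x1].
    have [|n nx] := @e_small (1 - x); first by rewrite subr_gt0.
    by exists n => //; rewrite /I/= in_itv/= (ltW x0)/=; lra.
apply: (@le_lt_trans _ _ (b^-1)%:E); last exact: ltry.
rewrite -(cvg_lim _ (@ge0_nondecreasing_set_cvg_integral _
  (measurableTypeR R) R I
  (fun x => ((1 - x) `^ (b - 1))%:E) mu _ _ _ _))//; last 3 first.
- by move=> m n mn; apply/subsetPset; exact: ndI.
- by move=> n; exact: measurable_itv.
- by move=> n; exact: measurable_funTS.
apply: lime_le.
  apply: ereal_nondecreasing_is_cvgn => m n mn.
  apply: ge0_subset_integral => //=.
  - exact: measurable_itv.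
  - exact: measurable_itv.
  - exact: measurable_funTS.
  - exact: ndI.
apply: nearW => n.
have en0 := e_gt0 n; have en1 := e_lt1 n.
rewrite integration_by_substitution_onem; last 2 first.
- by apply/andP; split; lra.
- apply: derivable_within_continuous => x; rewrite in_itv/= => /andP[_ xe].
  have x1 : 0 < 1 - x by lra.
  apply/derivable1_diffP.
  apply: (@differentiable_comp _ _ _ _ (fun y : R => 1 - y) (@powR R ^~ (b - 1))).
    by apply/derivable1_diffP; exact: derivableB.
  by apply/derivable1_diffP; apply: derivable_powR; rewrite in_itv/= andbT.
rewrite -/(unstable.onem (e_ n)) unstable.onemK.
under eq_integral do rewrite -/(unstable.onem _) unstable.onemK.
by apply: integral_pow_le => //; rewrite en0.
Qed.

Let weight_le a b x : 0 < a -> 0 < b -> 0 < x < 1 ->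
  rbeta_weight a b x <= 2 * x `^ (a - 1) + 2 * (1 - x) `^ (b - 1).
Proof.
move=> a0 b0 /andP[x0 x1].
have pow_le2 c y : 0 < c -> 1 / 2 <= y <= 1 -> y `^ (c - 1) <= 2.
  move=> c0 /andP[y2 y1]; have y0 : 0 < y by lra.
  apply: (@le_trans _ _ (y `^ (-1))).
    by apply: ger_powR; [rewrite y0|lra].
  by rewrite powR_inv1 ?(ltW y0)// invf_ple ?posrE//; lra.
have [x2|x2] := leP x (1 / 2).
  rewrite ler_wpDr ?mulr_ge0 ?powR_ge0// /rbeta_weight mulrC.
  by rewrite ler_wpM2r ?powR_ge0// pow_le2//; lra.
rewrite ler_wpDl ?mulr_ge0 ?powR_ge0// /rbeta_weight.
by rewrite ler_wpM2r ?powR_ge0// pow_le2//; lra.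
Qed.

Lemma integral_rbeta_weight_lty a b : 0 < a -> 0 < b ->
  (\int[mu]_(x in `]0%R, 1%R[) (rbeta_weight a b x)%:E < +oo)%E.
Proof.
move=> a0 b0.
have ml : measurable_fun setT (EFin \o (fun x : R => x `^ (a - 1))).
  by apply/measurable_EFinP; exact: measurable_powR.
have mr : measurable_fun setT (EFin \o (fun x : R => (1 - x) `^ (b - 1))).
  apply/measurable_EFinP.
  apply: (@measurableT_comp _ _ _ _ _ _ (@powR R ^~ (b - 1))) => //.
  exact: measurable_funB.
apply: (@le_lt_trans _ _ (\int[mu]_(x in `]0%R, 1%R[)
    (2%:E * (x `^ (a - 1))%:E + 2%:E * ((1 - x) `^ (b - 1))%:E))%E).
  apply: ge0_le_integral => //=.
  - by move=> x _; rewrite lee_fin rbeta_weight_ge0.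
  - apply: measurable_funTS; apply/measurable_EFinP.
    exact: measurable_rbeta_weight.
  - by apply: measurable_funTS; apply: emeasurable_funD;
      exact: measurable_funeM.
  - move=> x; rewrite in_itv/= => x01.
    by rewrite -!EFinM -EFinD lee_fin weight_le.
rewrite ge0_integralD//=.
- rewrite !ge0_integralZl//=.
  + by rewrite lte_add_pinfty// lte_mul_pinfty//
      ?integral_powl_lty ?integral_powr_lty.
  + exact: measurable_funTS.
  + by move=> x _; rewrite lee_fin powR_ge0.
  + exact: measurable_funTS.
  + by move=> x _; rewrite lee_fin powR_ge0.
- by move=> x _; rewrite -EFinM lee_fin mulr_ge0 ?powR_ge0.
- by apply: measurable_funTS; exact: measurable_funeM.
- by move=> x _; rewrite -EFinM lee_fin mulr_ge0 ?powR_ge0.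
- by apply: measurable_funTS; exact: measurable_funeM.
Qed.

Lemma EFin_rbeta_fun a b : 0 < a -> 0 < b ->
  (rbeta_fun a b)%:E = (\int[mu]_(x in `]0%R, 1%R[) (rbeta_weight a b x)%:E)%E.
Proof.
move=> a0 b0; rewrite /rbeta_fun /Rintegral fineK// ge0_fin_numE.
  exact: integral_rbeta_weight_lty.
by apply: integral_ge0 => x _; rewrite lee_fin rbeta_weight_ge0.
Qed.

Lemma rbeta_fun_gt0 a b : 0 < a -> 0 < b -> 0 < rbeta_fun a b.
Proof.
move=> a0 b0; rewrite -lte_fin EFin_rbeta_fun//.
pose c : R := (1 / 4) `^ a * (1 / 4) `^ b.
have c0 : 0 < c by rewrite mulr_gt0// powR_gt0//; lra.
apply: (@lt_le_trans _ _
    (\int[mu]_(x in `[(1 / 4)%R, (3 / 4)%R]) c%:E)%E).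
  rewrite integral_cst//= lebesgue_measure_itv/= lte_fin ifT; last lra.
  by rewrite -EFinB -EFinM lte_fin mulr_gt0//; lra.
have pow_ge (d y : R) : 0 < d -> 1 / 4 <= y <= 1 ->
    (1 / 4) `^ d <= y `^ (d - 1).
  move=> d0 /andP[y4 y1].
  apply: (@le_trans _ _ (y `^ d)).
    by apply: ge0_ler_powR; rewrite ?nnegrE//; lra.
  by apply: ger_powR; [apply/andP; split|]; lra.
apply: (@le_trans _ _
    (\int[mu]_(x in `[(1 / 4)%R, (3 / 4)%R]) (rbeta_weight a b x)%:E)%E).
  apply: ge0_le_integral => //=.
  - by move=> x _; rewrite lee_fin ltW.
  - apply: measurable_funTS; apply/measurable_EFinP.
    exact: measurable_rbeta_weight.
  - move=> x; rewrite in_itv/= => /andP[x4 x34].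
    by rewrite lee_fin ler_pM ?powR_ge0// pow_ge//; lra.
apply: ge0_subset_integral => //=.
- apply: measurable_funTS; apply/measurable_EFinP.
  exact: measurable_rbeta_weight.
- by move=> x _; rewrite lee_fin rbeta_weight_ge0.
- by move=> x /=; rewrite !in_itv/=; lra.
Qed.

Lemma integral_rbeta_pdf a b : 0 < a -> 0 < b ->
  (\int[mu]_x (rbeta_pdf a b x)%:E = 1)%E.
Proof.
move=> a0 b0.
rewrite (_ : (fun x => (rbeta_pdf a b x)%:E) =
    (fun x => (rbeta_weight a b x / rbeta_fun a b)%:E) \_ `]0, 1[); last first.
  by apply/funext => x; rewrite /rbeta_pdf !patchE; case: ifP.
rewrite -integral_mkcond; under eq_integral do rewrite EFinM.
rewrite ge0_integralZr//=.
- by rewrite -EFin_rbeta_fun// -EFinM divff// gt_eqF// rbeta_fun_gt0.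
- apply: measurable_funTS; apply/measurable_EFinP.
  exact: measurable_rbeta_weight.
- by move=> x _; rewrite lee_fin rbeta_weight_ge0.
- by rewrite lee_fin invr_ge0 rbeta_fun_ge0.
Qed.

End beta_density.

Section beta_probability.
Context {R : realType} (a b : R).
Local Notation mu := (@lebesgue_measure R).
Local Open Scope ereal_scope.

(* The positivity proofs are arguments so that Beta(a,b) is canonically a
   probability. *)
Definition rbeta_prob (a0 : (0 < a)%R) (b0 : (0 < b)%R) :
    set (measurableTypeR R) -> \bar R :=
  fun A => \int[mu]_(x in A) (rbeta_pdf a b x)%:E.

Hypotheses (a0 : (0 < a)%R) (b0 : (0 < b)%R).

Let rbeta0 : rbeta_prob a0 b0 set0 = 0.
Proof. by rewrite /rbeta_prob integral_set0. Qed.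

Let rbeta_ge0 A : 0 <= rbeta_prob a0 b0 A.
Proof. by apply: integral_ge0 => x _; rewrite lee_fin rbeta_pdf_ge0. Qed.

Let rbeta_sigma_additive : semi_sigma_additive (rbeta_prob a0 b0).
Proof.
move=> /= F mF tF mUF; rewrite /rbeta_prob; apply: cvg_toP.
  apply: ereal_nondecreasing_is_cvgn => m n mn.
  apply: lee_sum_nneg_natr => // k _ _.
  by apply: integral_ge0 => /= x Fkx; rewrite lee_fin rbeta_pdf_ge0.
rewrite ge0_integral_bigcup//=.
- apply: measurable_funTS; apply: measurableT_comp => //.
  exact: measurable_rbeta_pdf.
- by move=> x _; rewrite lee_fin rbeta_pdf_ge0.
Qed.

HB.instance Definition _ := isMeasure.Build _ _ _ (rbeta_prob a0 b0)
  rbeta0 rbeta_ge0 rbeta_sigma_additive.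

Let rbeta_setT : rbeta_prob a0 b0 setT = 1.
Proof. by rewrite /rbeta_prob integral_rbeta_pdf. Qed.

HB.instance Definition _ := @Measure_isProbability.Build _ _ R
  (rbeta_prob a0 b0) rbeta_setT.

End beta_probability.

Definition is_median {R : realType} (P : probability (measurableTypeR R) R)
    (m : R) : Prop :=
  ((1 / 2)%:E <= P `]-oo, m]%classic)%E /\
  ((1 / 2)%:E <= P `[m, +oo[%classic)%E.

Section modes.
Context {R : realType}.
Implicit Types (f : R -> R) (x m : R).

(* Only the values of f on ]0, 1[ matter below.  For f continuous there,
   cext_dom f is ]0, 1[ together with the endpoints at which f has a finite
   limit, and cext f is the continuous extension of f to cext_dom f. *)
Definition cext_dom f : set R :=
  [set x : R | 0 <= x <= 1 /\ cvg (f y @[y --> within `]0, 1[ (nbhs x)])].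

Definition cext f x : R := lim (f y @[y --> within `]0, 1[ (nbhs x)]).

Definition is_mode f m : Prop :=
  cext_dom f m /\ forall x, cext_dom f x -> cext f x <= cext f m.

Definition is_antimode f m : Prop :=
  cext_dom f m /\ forall x, cext_dom f x -> cext f m <= cext f x.

End modes.

(* Main.v *)
(* Each comparison of the median with a point c reduces to comparing
   P(X < c) and P(X > c), after folding one side of c onto the other by an
   affine map.  Write psi for the logarithm of the density, up to a constant.

   Mode M <= 1/2: reflecting at M, the derivative of
   t |-> psi(M + t) - psi(M - t) is nonnegative, so P(X < M) <= P(X > M).

   Anti-mode M >= 1/2: the expanding map M + (1 - M) u |-> M - M u does not
   decrease the density, by weighted AM-GM, so P(X > M) <= P(X < M).

   Mean m = a / (a + b) <= 1/2: psi(m + t) - psi(m - t) changes sign at most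
   once, at some t0, from minus to plus.  Hence
   (t - t0) (f(m + t) - f(m - t)) >= 0 for the density f and all t > 0;
   integrating, the first moments cancel and P(X > m) <= P(X < m). *)

Require Import Defs.
From mathcomp Require Import all_boot all_order all_algebra.
From mathcomp Require Import all_classical all_reals all_analysis.
From mathcomp Require Import ring lra measurable_realfun.

Set Implicit Arguments.
Unset Strict Implicit.
Unset Printing Implicit Defensive.

Import Order.TTheory GRing.Theory Num.Theory.
Import numFieldNormedType.Exports.

Local Open Scope classical_set_scope.
Local Open Scope ring_scope.

(** * The log-density and its asymmetry about a point *)

Section log_weight.
Context {R : realType}.
Implicit Types (A B m s t u x : R).

(** The exponents stay free instead of being [a - 1] and [b - 1]: later uses negate both, or write
    them as [k * m] and [k * (1 - m)]. *)
Definition log_weight A B x : R := A * ln x + B * ln (1 - x).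

Lemma rbeta_weight_expR (a b x : R) : 0 < x < 1 ->
  rbeta_weight a b x = expR (log_weight (a - 1) (b - 1) x).
Proof.
move=> /andP[x0 x1]; rewrite /rbeta_weight /powR /log_weight expRD.
by rewrite !gt_eqF// subr_gt0.
Qed.

Lemma is_derive_log_weight A B x : 0 < x < 1 ->
  is_derive x 1 (log_weight A B) (A / x - B / (1 - x)).
Proof.
move=> /andP[x0 x1]; have x1' : 0 < 1 - x by rewrite subr_gt0.
have d1 := is_derive1_ln x0.
have d2 : is_derive x 1 (fun y : R => ln (1 - y)) (- (1 - x)^-1).
  have d3 := is_derive1_ln x1'.
  have d4 : is_derive x 1 (fun y : R => 1 - y) (- 1).
    by apply: is_derive_eq; ring.
  have := @is_derive1_comp R (@ln R) (fun y : R => 1 - y) x _ _ d3 d4.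
  by rewrite mulrN1.
apply: is_derive_eq; rewrite /GRing.scale/=.
by rewrite mulrN.
Qed.

Definition log_ratio A B m t : R :=
  log_weight A B (m + t) - log_weight A B (m - t).

Lemma log_ratioN A B m t : log_ratio (- A) (- B) m t = - log_ratio A B m t.
Proof. by rewrite /log_ratio /log_weight; ring. Qed.

Lemma log_ratio0 A B m : log_ratio A B m 0 = 0.
Proof. by rewrite /log_ratio addr0 subr0 subrr. Qed.

(** Over this common denominator, positive for [0 <= t < m <= 1 / 2], the sign of the derivative is
    that of a polynomial of degree at most 2 in [t]. *)
Lemma is_derive_log_ratio A B m t : m <= 1 / 2 -> 0 <= t < m ->
  is_derive t 1 (log_ratio A B m)
    (2 * (A * m * ((1 - m) ^+ 2 - t ^+ 2) - B * (1 - m) * (m ^+ 2 - t ^+ 2)) /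
     ((m ^+ 2 - t ^+ 2) * ((1 - m) ^+ 2 - t ^+ 2))).
Proof.
move=> m2 /andP[t0 tm].
have d1 : is_derive t 1 (log_weight A B \o (fun y => m + y))
    (A / (m + t) - B / (1 - (m + t))).
  have d3 : is_derive (m + t) 1 (log_weight A B)
      (A / (m + t) - B / (1 - (m + t))).
    by apply: is_derive_log_weight; apply/andP; split; lra.
  have d4 : is_derive t 1 (fun y : R => m + y) 1.
    by apply: is_derive_eq; ring.
  have := @is_derive1_comp R (log_weight A B) (fun y : R => m + y) t _ _ d3 d4.
  by rewrite mulr1.
have d2 : is_derive t 1 (log_weight A B \o (fun y => m - y))
    (- (A / (m - t) - B / (1 - (m - t)))).
  have d3 : is_derive (m - t) 1 (log_weight A B)
      (A / (m - t) - B / (1 - (m - t))).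
    by apply: is_derive_log_weight; apply/andP; split; lra.
  have d4 : is_derive t 1 (fun y : R => m - y) (- 1).
    by apply: is_derive_eq; ring.
  have := @is_derive1_comp R (log_weight A B) (fun y : R => m - y) t _ _ d3 d4.
  by rewrite mulrN1.
have := @is_deriveB _ _ _ _ _ _ _ _ _ d1 d2.
rewrite (_ : _ - _ = 2 * (A * m * ((1 - m) ^+ 2 - t ^+ 2) -
    B * (1 - m) * (m ^+ 2 - t ^+ 2)) /
     ((m ^+ 2 - t ^+ 2) * ((1 - m) ^+ 2 - t ^+ 2)))//.
field.
have h1 : 0 < m ^+ 2 - t ^+ 2 by rewrite subr_sqr mulr_gt0//; lra.
have h2 : 0 < (1 - m) ^+ 2 - t ^+ 2 by rewrite subr_sqr mulr_gt0//; lra.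
by rewrite !gt_eqF//; lra.
Qed.

Lemma log_ratio_homo A B m s t : m <= 1 / 2 -> 0 <= s -> s <= t -> t < m ->
  (forall u, s < u < t ->
    0 <= A * m * ((1 - m) ^+ 2 - u ^+ 2) - B * (1 - m) * (m ^+ 2 - u ^+ 2)) ->
  log_ratio A B m s <= log_ratio A B m t.
Proof.
move=> m2 s0 st tm h.
apply: (@ger0_derive1_le_cc _ (log_ratio A B m) s t) => //.
- move=> u; rewrite in_itv/= => /andP[su ut].
  by have [] // := @is_derive_log_ratio A B m u m2 _; apply/andP; split; lra.
- move=> u; rewrite in_itv/= => /andP[su ut].
  have ? : 0 <= u < m by apply/andP; split; lra.
  have [_ ] := @is_derive_log_ratio A B m u m2 ltac:(done).
  rewrite derive1E => ->; rewrite divr_ge0//.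
    by rewrite mulr_ge0// h// su ut.
  by rewrite mulr_ge0// subr_sqr mulr_ge0//; lra.
- apply: derivable_within_continuous => u; rewrite in_itv/= => /andP[su ut].
  by have [] // := @is_derive_log_ratio A B m u m2 _; apply/andP; split; lra.
- by rewrite in_itv/= lexx.
- by rewrite in_itv/= lexx andbT.
Qed.

(** When the exponents are proportional to [m] and [1 - m], so that [m] is a critical point, the
    constant term of the numerator cancels and [k * (u ^+ 2 * (1 - 2 * m))] remains. *)
Lemma log_ratio_mode k m t : 0 <= k -> m <= 1 / 2 -> 0 <= t < m ->
  0 <= log_ratio (k * m) (k * (1 - m)) m t.
Proof.
move=> k0 m2 /andP[t0 tm]; rewrite -(log_ratio0 (k * m) (k * (1 - m)) m).
apply: log_ratio_homo => // u _.
rewrite (_ : _ - _ = k * (u ^+ 2 * (1 - 2 * m))); last by ring.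
by apply: mulr_ge0 => //; apply: mulr_ge0; [exact: sqr_ge0|lra].
Qed.

(** Up to the factor [1 - 2 * m >= 0], the derivative of the log-ratio has the sign of
    [(k - 1) * u ^+ 2 - m * (1 - m)], which can only pass from negative to positive. The log-ratio
    starts at 0, so it is nonpositive at first and, once positive, never negative again. *)
Lemma log_ratio_crossing a b : 0 < a -> a <= b -> let m := a / (a + b) in
  exists2 t0, 0 < t0 <= m &
    (forall t, 0 < t < t0 -> log_ratio (a - 1) (b - 1) m t <= 0) /\
    (forall t, t0 < t < m -> 0 <= log_ratio (a - 1) (b - 1) m t).
Proof.
move=> a0 ab m; pose k := a + b.
have k0 : 0 < k by rewrite /k; lra.
have am : a = k * m by rewrite /m mulrC divfK// gt_eqF.
have bm : b = k * (1 - m) by rewrite mulrBr mulr1 -am /k; lra.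
have m0 : 0 < m by rewrite divr_gt0.
have m2 : m <= 1 / 2.
  by rewrite /m ler_pdivrMr//; lra.
have E u : (a - 1) * m * ((1 - m) ^+ 2 - u ^+ 2) -
    (b - 1) * (1 - m) * (m ^+ 2 - u ^+ 2) =
    (1 - 2 * m) * ((k - 1) * u ^+ 2 - m * (1 - m)).
  by rewrite bm am; ring.
set L := log_ratio _ _ m.
(* Before the derivative changes sign, the log-ratio stays below its value 0 at the origin. *)
have Lle0 s : 0 < s < m -> (k - 1) * s ^+ 2 <= m * (1 - m) -> L s <= 0.
  move=> /andP[s0 sm] ks; rewrite -oppr_ge0 /L -log_ratioN.
  rewrite -(log_ratio0 (- (a - 1)) (- (b - 1)) m).
  apply: log_ratio_homo => //; first exact: ltW.
  move=> u /andP[u0 us].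
  rewrite !mulNr -opprD oppr_ge0 E mulr_ge0_le0//; first lra.
  rewrite subr_le0; have [k1|k1] := leP (k - 1) 0.
    apply: (@le_trans _ _ 0); last by rewrite mulr_ge0//; lra.
    by rewrite mulr_le0_ge0// sqr_ge0.
  by rewrite (le_trans _ ks)// ler_pM2l// lerXn2r ?nnegrE//; lra.
(* By contraposition of [Lle0], positivity at [s] places [s] beyond the sign change, where the
   log-ratio is nondecreasing. *)
have Lge0 s t : 0 < s -> s <= t -> t < m -> 0 < L s -> 0 <= L t.
  move=> s0 st tm Ls; apply: (le_trans (ltW Ls)).
  apply: log_ratio_homo => //; first exact: ltW.
  move=> u /andP[su ut]; rewrite E mulr_ge0//; first lra.
  have ks : m * (1 - m) < (k - 1) * s ^+ 2.
    by rewrite ltNge; apply/negP => /(Lle0 s ltac:(lra)); rewrite leNgt Ls.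
  have k1 : 0 < k - 1.
    rewrite -(pmulr_lgt0 (x := s ^+ 2)) ?exprn_gt0//.
    by rewrite (lt_trans _ ks)// mulr_gt0//; lra.
  rewrite subr_ge0 (le_trans (ltW ks))// ler_pM2l// lerXn2r ?nnegrE//; lra.
(* The crossing point is the infimum of the points with positive log-ratio, or [m] if there are
   none. *)
pose S := [set s | 0 < s < m /\ 0 < L s].
have [[s1 [s1m Ls1]]|nS] := pselect (exists s, S s); last first.
  exists m; first by rewrite m0 lexx.
  split => t /andP[t0 t1]; last by lra.
  rewrite leNgt; apply/negP => Lt; apply: nS; exists t; split => //.
  exact/andP.
(* A positive lower bound for [S] makes its infimum positive: [(k - 1) * s ^+ 2 <= k * s] because
   [0 < s < 1]. *)
have lbS s : S s -> m * (1 - m) / k < s.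
  move=> [/andP[s0 sm] Ls]; rewrite ltr_pdivrMr// mulrC.
  have ks : m * (1 - m) < (k - 1) * s ^+ 2.
    by rewrite ltNge; apply/negP => /(Lle0 s ltac:(lra)); rewrite leNgt Ls.
  nra.
have hi : has_inf S.
  by split; [exists s1|exists (m * (1 - m) / k) => s /lbS/ltW].
exists (inf S).
  apply/andP; split.
    apply: (@lt_le_trans _ _ (m * (1 - m) / k)).
      by rewrite divr_gt0// mulr_gt0//; lra.
    by apply: lb_le_inf; [exists s1|move=> s /lbS/ltW].
  apply: (@le_trans _ _ s1); last by case/andP: s1m => _ /ltW.
  by apply: ge_inf; [case: hi|].
split => t /andP[t0 t1].
  rewrite leNgt; apply/negP => Lt.
  move: (t1); rewrite ltNge => /negP; apply; apply: ge_inf; [by case: hi|].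
  split => //; rewrite t0/= (lt_le_trans t1)//.
  apply: (@le_trans _ _ s1); last by case/andP: s1m => _ /ltW.
  by apply: ge_inf; [case: hi|].
(* Some point of [S] lies below [t], and [Lge0] carries the sign from there to [t]. *)
have [|s [/andP[s0 _] Ls] st] := @inf_adherent _ S (t - inf S) _ hi.
  by rewrite subr_gt0.
by apply: (Lge0 s) => //; rewrite ltW//; lra.
Qed.

(* After cancellation this is concavity of ln at the points 1 - u and
   (1 - M + M u) / (1 - M), with weights 2 M - 1 and 1 - M. *)
Lemma log_weight_antimode k M u : k <= 0 -> 1 / 2 <= M < 1 -> 0 < u < 1 ->
  log_weight (k * M) (k * (1 - M)) (M + (1 - M) * u) <=
  log_weight (k * M) (k * (1 - M)) (M - M * u).
Proof.
move=> k0 /andP[M2 M1] /andP[u0 u1].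
have M0 : 0 < M by lra.
have N0 : 0 < 1 - M by lra.
have ln_tangent (y z : R) : 0 < y -> 0 < z -> ln y <= ln z + y / z - 1.
  move=> y0 z0; have yz : 0 < y / z by rewrite divr_gt0.
  have := @le_ln1Dx _ (y / z - 1); rewrite subrKC ln_div ?posrE//.
  by move=> /(_ ltac:(lra)); lra.
pose z := M + (1 - M) * u; pose w := 1 - M + M * u.
have z0 : 0 < z by rewrite ltr_wpDr// mulr_ge0// ltW.
have w0 : 0 < w by rewrite ltr_wpDr// mulr_ge0// ltW.
have v0 : 0 < 1 - u by lra.
have E1 : 1 - z = (1 - M) * (1 - u) by rewrite /z; ring.
have E2 : M - M * u = M * (1 - u) by ring.
have E3 : 1 - (M - M * u) = w by rewrite /w; ring.
have zM : 0 < z / M by rewrite divr_gt0.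
have wN : 0 < w / (1 - M) by rewrite divr_gt0.
rewrite /log_weight -/z E1 E3 E2 !lnM ?posrE//.
have t1 := ln_tangent _ _ v0 zM.
have t2 := ln_tangent _ _ wN zM.
rewrite !ln_div ?posrE// in t1 t2.
(* [z / M] is the barycentre of the two points, so the linear terms of the tangent bounds taken at
   [z / M] cancel in the weighted sum. *)
have key : (2 * M - 1) * ((1 - u) / (z / M)) +
    (1 - M) * (w / (1 - M) / (z / M)) = M.
  by rewrite /w /z; field; rewrite -/z !gt_eqF.
have t3 : (2 * M - 1) * ln (1 - u) <= (2 * M - 1) *
    (ln z - ln M + (1 - u) / (z / M) - 1) by rewrite ler_wpM2l//; lra.
have t4 : (1 - M) * (ln w - ln (1 - M)) <= (1 - M) *
    (ln z - ln M + w / (1 - M) / (z / M) - 1) by rewrite ler_wpM2l//; lra.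
have t5 : M * (ln M + ln (1 - u)) + (1 - M) * ln w <=
    M * ln z + (1 - M) * (ln (1 - M) + ln (1 - u)) by lra.
by rewrite -!mulrA -!mulrDr; exact: ler_wnM2l.
Qed.

End log_weight.

(** * Affine changes of variable and improper integrals *)

Section integral_lemmas.
Context {R : realType}.
Local Notation mu := (@lebesgue_measure R).
Local Open Scope ereal_scope.

(** The pushforward of Lebesgue measure by [x |-> d - r * x], scaled by [r], agrees with Lebesgue
    measure on half-open intervals, hence on all measurable sets. *)
Lemma ge0_integral_reflection (d r : R) (f : R -> \bar R) (D : set R) :
  (0 < r)%R -> measurable D -> measurable_fun setT f -> (forall x, 0 <= f x) ->
  \int[mu]_(x in D) f x =
  r%:E * \int[mu]_(x in [set x : R | D (d - r * x)%R]) f (d - r * x)%R.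
Proof.
move=> r0 mD mf f0.
pose phi : measurableTypeR R -> measurableTypeR R := fun x => (d - r * x)%R.
have mphi : measurable_fun setT phi.
  by apply: measurable_funB => //; exact: measurable_funM.
have r0' : (0 <= r)%R by exact: ltW.
pose nu' := mscale (NngNum r0') (pushforward mu phi).
pose nu := nu' mphi.
have munu A : measurable A -> mu A = nu A.
  apply: lebesgue_measure_unique => _ [[u v]] _ <-.
  rewrite -[RHS]/(r%:E * mu (phi @^-1` `]u, v]%classic)).
  (* The map is decreasing, so the closed end of the interval changes sides; the length is
     unaffected. *)
  rewrite (_ : phi @^-1` _ = `[((d - v) / r)%R, ((d - u) / r)%R[%classic).
    rewrite !lebesgue_measure_itv/= !lte_fin ltr_pM2r ?invr_gt0// ltrD2l ltrN2.
    case: ifPn => uv; last by rewrite mule0.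
    by rewrite -!EFinB -EFinM; congr EFin; field; rewrite gt_eqF.
  apply/seteqP; split => x /=; rewrite !in_itv/= /phi => /andP[h1 h2].
    by rewrite ler_pdivrMr// ltr_pdivlMr//; apply/andP; split; lra.
  by move: h1 h2; rewrite ler_pdivrMr// ltr_pdivlMr// => *; apply/andP; split; lra.
transitivity (\int[nu]_(x in D) f x).
  by apply: eq_measure_integral => A mA _; exact: munu.
rewrite ge0_integral_mscale//; last exact: measurable_funTS.
congr (_ * _).
by rewrite (ge0_integral_pushforward mphi)//; exact: measurable_funTS.
Qed.

Lemma eq_integral_subset (D E : set R) (f : R -> \bar R) : D `<=` E ->
  (forall x, E x -> ~ D x -> f x = 0) ->
  \int[mu]_(x in E) f x = \int[mu]_(x in D) f x.
Proof.
move=> DE f0; rewrite integral_mkcond [RHS]integral_mkcond.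
apply: eq_integral => x _; rewrite !patchE.
have [xD|xD] := boolP (x \in D).
  by rewrite mem_set//; apply: DE; exact: set_mem.
case: ifPn => // /set_mem Ex; apply: f0 => // Dx.
by move/negP: xD; apply; exact: mem_set.
Qed.

(** The integrand may blow up at [u] and [v], so the theorem for segments is applied on [I n], which
    increase to the open interval; monotone convergence handles the integrals, and the one-sided
    limits of [F] the boundary terms. *)
Lemma ge0_integral_itvoo_FTC (f F : R -> R) (u v l r : R) : (u < v)%R ->
  measurable_fun setT f ->
  (forall x, (u < x < v)%R -> (0 <= f x)%R) ->
  (forall x, (u < x < v)%R -> {for x, continuous f}) ->
  (forall x, (u < x < v)%R -> is_derive x (1:R)%R F (f x)) ->
  F x @[x --> u^'+] --> l -> F x @[x --> v^'-] --> r ->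
  \int[mu]_(x in `]u, v[) (f x)%:E = (r - l)%:E.
Proof.
move=> uv mf f0 cf dF Fl Fr.
(* The denominator is at least 3 so that [2 * e n < v - u] and every segment [I n] is
   nondegenerate. *)
pose e n : R := ((v - u) * (n.+3%:R)^-1)%R.
have e0 n : (0 < e n)%R by rewrite mulr_gt0// subr_gt0.
have e2 n : (e n + e n < v - u)%R.
  rewrite -mulr2n -mulr_natr -mulrA gtr_pMr ?subr_gt0//.
  by rewrite ltr_pdivrMl// mulr1 ltr_nat.
have eni m n : (m <= n)%N -> (e n <= e m)%R.
  move=> mn; rewrite ler_pM2l ?subr_gt0//.
  by rewrite lef_pV2 ?posrE// ler_nat !ltnS.
have ecvg : e n @[n --> \oo] --> (0 : R)%R.
  rewrite -(mulr0 (v - u)%R); apply: cvgM; first exact: cvg_cst.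
  rewrite (_ : (fun n => _) = (fun n => harmonic (n + 2)%N)); last first.
    by apply/funext => n; rewrite /= addn2.
  by rewrite (cvg_shiftn 2); exact: cvg_harmonic.
pose I n : set R := `[(u + e n)%R, (v - e n)%R]%classic.
have -> : `]u, v[%classic = \bigcup_n I n.
  apply/seteqP; split => x /=; last first.
    move=> [n _]; rewrite /I/= !in_itv/= => /andP[h1 h2].
    by have := e0 n; move=> ?; apply/andP; split; lra.
  rewrite in_itv/= => /andP[ux xv].
  have mn : (0 < Num.min (x - u) (v - x))%R by rewrite lt_min !subr_gt0 ux xv.
  have [N _ /(_ N (leqnn N))] := cvgr_lt 0%R ecvg _ mn.
  rewrite /= lt_min => /andP[h1 h2].
  by exists N => //; rewrite /I/= in_itv/=; apply/andP; split; lra.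
have h1 := @ge0_nondecreasing_set_cvg_integral _ (measurableTypeR R) R I
  (EFin \o f) mu.
have {}h1 : \int[mu]_(x in I n) (f x)%:E @[n --> \oo] -->
    \int[mu]_(x in \bigcup_n I n) (f x)%:E.
  apply: h1.
  - move=> m n mn; apply/subsetPset; apply: subset_itv; rewrite bnd_simp.
      by rewrite lerD2l eni.
    by rewrite lerD2l lerN2 eni.
  - by move=> n; exact: measurable_itv.
  - by move=> n; apply: measurable_funTS; exact/measurable_EFinP.
  - move=> n x; rewrite /I/= in_itv/= => /andP[h1 h2].
    by have := e0 n => ?; rewrite lee_fin f0//; apply/andP; split; lra.
have h2 : \int[mu]_(x in I n) (f x)%:E @[n --> \oo] --> (r - l)%:E.
  have -> : (fun n => \int[mu]_(x in I n) (f x)%:E) =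
      (fun n => (F (v - e n) - F (u + e n))%R%:E).
    apply/funext => n; have := e0 n; have := e2 n => ? ?.
    have dF' x : (u + e n <= x <= v - e n)%R -> is_derive x (1:R)%R F (f x).
      by move=> /andP[? ?]; apply: dF; apply/andP; split; lra.
    have cF x : (u + e n <= x <= v - e n)%R -> {for x, continuous F}.
      move=> /dF' d; apply: differentiable_continuous; apply/derivable1_diffP.
      by case: d.
    rewrite (@continuous_FTC2 _ _ F)//.
    - lra.
    - apply: continuous_in_subspaceT => x; rewrite inE/= in_itv/= => /andP[? ?].
      by apply: cf; apply/andP; split; lra.
    - split.
      + move=> x; rewrite in_itv/= => /andP[? ?].
        by have [] // := dF' x ltac:(apply/andP; split; lra).
      + by apply: cvg_at_right_filter; apply: cF; apply/andP; split; lra.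
      + by apply: cvg_at_left_filter; apply: cF; apply/andP; split; lra.
    - move=> x; rewrite in_itv/= => /andP[? ?]; rewrite derive1E.
      by have [_ ->] := dF' x ltac:(apply/andP; split; lra).
  apply: cvg_EFin; first by exact: nearW.
  apply: cvgB.
    move/cvg_at_leftP : Fr; apply; split; first by move=> n; rewrite ltrBlDr ltrDl.
    by rewrite -[X in _ --> X]subr0; apply: cvgB => //; exact: cvg_cst.
  move/cvg_at_rightP : Fl; apply; split; first by move=> n; rewrite ltrDl.
  by rewrite -[X in _ --> X]addr0; apply: cvgD => //; exact: cvg_cst.
by rewrite -(cvg_lim _ h1)// -(cvg_lim _ h2).
Qed.

End integral_lemmas.

(** * Integration against a measure given by a density *)

Section ge0_integral_density.
Local Open Scope ereal_scope.
Context d (T : measurableType d) (R : realType).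
Variables (mu nu : {measure set T -> \bar R}) (p : T -> R).
Hypotheses (mp : measurable_fun setT p) (p0 : forall x, (0 <= p x)%R).
Hypothesis nuE : forall A, measurable A -> nu A = \int[mu]_(x in A) (p x)%:E.

Import HBNNSimple.

(** Monotone convergence on both sides reduces the claim to simple functions, and splitting these
    over their fibres reduces it to indicators, where it is [nuE]. *)
Lemma ge0_integral_density (f : T -> \bar R) :
  measurable_fun setT f -> (forall x, 0 <= f x) ->
  \int[nu]_x f x = \int[mu]_x (f x * (p x)%:E).
Proof.
move=> mf f0; pose f_ := nnsfun_approx measurableT mf.
have f_f x : (f_ n x)%:E @[n --> \oo] --> f x by exact: cvg_nnsfun_approx.
transitivity (limn (fun n => \int[nu]_x (f_ n x)%:E)).
  rewrite -monotone_convergence//.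
  - by apply: eq_integral => x _; exact/esym/cvg_lim.
  - by move=> n; exact/measurable_EFinP/measurable_funP.
  - by move=> n x _; rewrite lee_fin.
  - by move=> x _ m n mn; rewrite lee_fin; exact/lefP/nd_nnsfun_approx.
transitivity (limn (fun n => \int[mu]_x ((f_ n x)%:E * (p x)%:E))); last first.
  rewrite -monotone_convergence//.
  - apply: eq_integral => x _; apply/cvg_lim => //.
    by apply: cvgeZr => //; exact: f_f.
  - move=> n; apply: emeasurable_funM; exact/measurable_EFinP.
  - by move=> n x _; rewrite mule_ge0// lee_fin.
  - move=> x _ m n mn; rewrite lee_wpmul2r// lee_fin ?p0//.
    exact/lefP/nd_nnsfun_approx.
congr (limn _); apply/funext => n.
(* A negative [y] has empty fibre, since the simple functions are nonnegative. *)
have nn y x : (0 <= y * \1_(f_ n @^-1` [set y]) x)%R.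
  by rewrite indicE; have [/set_mem/= <-|_] := boolP (x \in _); rewrite ?mulr1 ?mulr0.
under eq_integral do rewrite fimfunE -fsumEFin//.
rewrite ge0_integral_fsum//; last 2 first.
- by move=> y; exact/measurable_EFinP/measurable_funM.
- by move=> y x _; rewrite lee_fin nn.
transitivity (\int[mu]_x \sum_(y \in range (f_ n))
    ((y * \1_(f_ n @^-1` [set y]) x)%:E * (p x)%:E)); last first.
  apply: eq_integral => x _.
  rewrite [in RHS]fimfunE -fsumEFin// ge0_mule_fsuml// => y.
  by rewrite lee_fin nn.
rewrite ge0_integral_fsum//; last 2 first.
- move=> y; apply: emeasurable_funM; apply/measurable_EFinP => //.
  exact: measurable_funM.
- by move=> y x _; rewrite mule_ge0// lee_fin ?nn ?p0.
apply: eq_fsbigr => y /set_mem[z _ fzy]; rewrite integralZl_indic_nnsfun//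
  integral_indic//=.
rewrite setIT nuE//.
have y0 : (0 <= y)%R by rewrite -fzy.
rewrite -ge0_integralZl//=; last 2 first.
- by apply: measurable_funTS; exact/measurable_EFinP.
- by move=> x _; rewrite lee_fin.
rewrite [LHS]integral_mkcond; apply: eq_integral => x _.
rewrite patchE indicE; case: ifPn => _; last by rewrite mulr0 mul0e.
by rewrite mulr1.
Qed.

End ge0_integral_density.
(** Folds the left side of [x] onto the right side. The ratio [r] is 1 for the mode and the mean;
    for the anti-mode it is chosen so that 1 goes to 0. *)
Lemma integral_itvNyo_reflection (R : realType) (x r : R) (f : R -> R) :
  0 < r ->
  measurable_fun setT f -> (forall y, 0 <= f y) ->
  (\int[lebesgue_measure]_(y in `]-oo, x[) (f y)%:E =
   \int[lebesgue_measure]_(y in `]x, +oo[) (r * f (x - r * (y - x)))%:E)%E.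
Proof.
move=> r0 mf f0.
rewrite (@ge0_integral_reflection _ (x + r * x) r (EFin \o f))//=; last first.
  exact/measurable_EFinP.
rewrite (_ : [set _ | _] = `]x, +oo[%classic); last first.
  apply/seteqP; split => y /=; rewrite !in_itv/= andbT => h.
    by rewrite -(ltr_pM2l r0); lra.
  by move: h; rewrite -(ltr_pM2l r0); lra.
rewrite -ge0_integralZl//=.
- by apply: eq_integral => y _; rewrite EFinM; congr (_ * (f _)%:E)%E; ring.
- apply: measurable_funTS; apply/measurable_EFinP.
  apply: (@measurableT_comp _ _ _ _ _ _ f) => //.
  by apply: measurable_funB => //; exact: measurable_funM.
- by move=> y _; rewrite lee_fin.
- by rewrite lee_fin ltW.
Qed.

(** * Masses of half-lines and medians *)

Section median.
Context {R : realType} (P : probability (measurableTypeR R) R).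
Local Open Scope ereal_scope.

Let P1 (u : R) : P `]u, +oo[%classic = 1 - P `]-oo, u]%classic.
Proof. by rewrite -probability_setC//; congr (P _); rewrite setCitvl. Qed.

Let P2 (u : R) : P `[u, +oo[%classic = 1 - P `]-oo, u[%classic.
Proof. by rewrite -probability_setC//; congr (P _); rewrite setCitvl. Qed.

(** The chain is [P(X <= x) >= P(X < x) >= P(X > x) = 1 - P(X <= x)]. *)
Lemma half_le_itvNyc (x : R) :
  P `]x, +oo[%classic <= P `]-oo, x[%classic ->
  (1 / 2)%:E <= P `]-oo, x]%classic.
Proof.
move=> h; have : P `]x, +oo[%classic <= P `]-oo, x]%classic.
  apply: (le_trans h); apply: le_measure; rewrite ?inE//.
  by apply: subset_itvl; rewrite bnd_simp.
rewrite P1; have : P `]-oo, x]%classic \is a fin_num by exact: fin_num_measure.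
case: (P _) => // q _. rewrite -EFinB !lee_fin; lra.
Qed.

Lemma half_le_itvcy (x : R) :
  P `]-oo, x[%classic <= P `]x, +oo[%classic ->
  (1 / 2)%:E <= P `[x, +oo[%classic.
Proof.
move=> h; have : P `]-oo, x[%classic <= P `[x, +oo[%classic.
  apply: (le_trans h); apply: le_measure; rewrite ?inE//.
  by apply: subset_itvr; rewrite bnd_simp.
rewrite P2; have : P `]-oo, x[%classic \is a fin_num by exact: fin_num_measure.
case: (P _) => // q _. rewrite -EFinB !lee_fin; lra.
Qed.

(** The two half-lines already use up the total mass 1, leaving none for the gap between them. *)
Lemma half_disjoint_itv (u v : R) : (u < v)%R -> 0 < P `]u, v[%classic ->
  (1 / 2)%:E <= P `]-oo, u]%classic ->
  (1 / 2)%:E <= P `[v, +oo[%classic -> False.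
Proof.
move=> uv; rewrite P2.
have -> : P `]-oo, v[%classic = P `]-oo, u]%classic + P `]u, v[%classic.
  rewrite -measureU//; last first.
    apply/seteqP; split => x//=; rewrite !in_itv/= => -[h1 /andP[h2 _]].
    by move: h1; rewrite leNgt h2.
  by rewrite -itv_bndbnd_setU.
have : P `]-oo, u]%classic \is a fin_num by exact: fin_num_measure.
have : P `]u, v[%classic \is a fin_num by exact: fin_num_measure.
case: (P `]u, v[%classic) => // q _; case: (P _) => // r _.
change (0 < q%:E -> (1 / 2)%:E <= r%:E -> (1 / 2)%:E <= (1 - (r + q))%:E -> False).
by rewrite !lee_fin lte_fin; lra.
Qed.

End median.

(** * Comparing the median of a beta law with a given point *)

Section rbeta_median.
Context {R : realType} (a b : R) (a0 : 0 < a) (b0 : 0 < b).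
Local Notation mu := (@lebesgue_measure R).
Local Notation p := (rbeta_pdf a b).
Local Notation P := (rbeta_prob a0 b0).
Local Notation psi := (log_weight (a - 1) (b - 1)).

Lemma rbeta_pdf_in (x : R) : 0 < x < 1 ->
  p x = rbeta_weight a b x / rbeta_fun a b.
Proof. by move=> x01; rewrite /rbeta_pdf patchE mem_set//= in_itv. Qed.

Lemma rbeta_pdf_out (x : R) : ~ (0 < x < 1) -> p x = 0.
Proof. by move=> x01; rewrite /rbeta_pdf patchE memNset//= in_itv. Qed.

Lemma rbeta_pdf_le (x y : R) : 0 < x < 1 -> 0 < y < 1 ->
  (p x <= p y) = (psi x <= psi y).
Proof.
move=> x01 y01; rewrite !rbeta_pdf_in// ler_pM2r ?invr_gt0 ?rbeta_fun_gt0//.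
by rewrite !rbeta_weight_expR// ler_expR.
Qed.

Lemma rbeta_probE A : P A = (\int[mu]_(x in A) (p x)%:E)%E.
Proof. by []. Qed.

Let mpE D : measurable_fun D (fun x => (p x)%:E).
Proof.
by apply: measurable_funTS; apply/measurable_EFinP; exact: measurable_rbeta_pdf.
Qed.

Lemma rbeta_prob_itv_gt0 (u v : R) : u < v -> u < 1 -> 0 < v ->
  (0 < P `]u, v[%classic)%E.
Proof.
move=> uv u1 v0; rewrite rbeta_probE.
pose u' := Num.max u 0; pose v' := Num.min v 1.
have uv' : u' < v' by rewrite gt_max !lt_min uv u1 v0 ltr01.
have [uu' u'0] : u <= u' /\ 0 <= u' by rewrite !le_max !lexx orbT.
have [vv' v'1] : v' <= v /\ v' <= 1 by rewrite !ge_min !lexx orbT.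
(* The middle third keeps away from 0 and 1, where the density may vanish or blow up. *)
pose c := (2 * u' + v') / 3; pose d := (u' + 2 * v') / 3.
have c0 : 0 < c by rewrite /c; lra.
have d1 : d < 1 by rewrite /d; lra.
have cd : c < d by rewrite /c /d; lra.
(* The exponents [a] and [b] give a lower bound whatever the signs of [a - 1] and [b - 1], since
   lowering the exponent by 1 increases a power of a base in []0, 1]]. *)
pose k := c `^ a * (1 - d) `^ b / rbeta_fun a b.
have k0 : 0 < k.
  by rewrite divr_gt0 ?rbeta_fun_gt0// mulr_gt0// powR_gt0// subr_gt0.
apply: (@lt_le_trans _ _ (\int[mu]_(x in `[c, d]) k%:E)%E).
  rewrite integral_cst//= lebesgue_measure_itv/= lte_fin cd.
  by rewrite -EFinB -EFinM lte_fin mulr_gt0// subr_gt0.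
have pow_ge (e y z : R) : 0 < e -> 0 < z -> z <= y <= 1 -> z `^ e <= y `^ (e - 1).
  move=> e0 z0 /andP[zy y1]; apply: (@le_trans _ _ (y `^ e)).
    by apply: ge0_ler_powR; rewrite ?nnegrE//; lra.
  by apply: ger_powR; [apply/andP; split|]; lra.
apply: (@le_trans _ _ (\int[mu]_(x in `[c, d]) (p x)%:E)%E).
  apply: ge0_le_integral => //=.
  - by move=> x _; rewrite lee_fin ltW.
  - exact: mpE.
  - move=> x; rewrite in_itv/= => /andP[cx xd].
    rewrite lee_fin rbeta_pdf_in; last by apply/andP; split; lra.
    rewrite ler_pM2r ?invr_gt0 ?rbeta_fun_gt0// ler_pM ?powR_ge0// pow_ge//; lra.
apply: ge0_subset_integral => //=.
- exact: mpE.
- by move=> x _; rewrite lee_fin rbeta_pdf_ge0.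
- by move=> x /=; rewrite !in_itv/= /c /d => /andP[? ?]; apply/andP; split; lra.
Qed.

Lemma is_median_ge0 md : is_median P md -> 0 <= md.
Proof.
move=> [h _]; rewrite leNgt; apply/negP => md0.
move: h; rewrite -[leRHS]/(\int[mu]_(x in `]-oo, md]) (p x)%:E)%E.
rewrite integral0_eq ?lee_fin; first lra.
move=> x; rewrite /= in_itv/= => xm.
by rewrite rbeta_pdf_out// => /andP[? ?]; lra.
Qed.

Lemma is_median_le1 md : is_median P md -> md <= 1.
Proof.
move=> [_ h]; rewrite leNgt; apply/negP => md0.
move: h; rewrite -[leRHS]/(\int[mu]_(x in `[md, +oo[) (p x)%:E)%E.
rewrite integral0_eq ?lee_fin; first lra.
move=> x; rewrite /= in_itv/= andbT => xm.
by rewrite rbeta_pdf_out// => /andP[? ?]; lra.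
Qed.

(** If [md] exceeded [x], the interval between them would meet []0, 1[] and carry mass, while the
    half-lines on either side of it carry at least 1/2 each. *)
Lemma median_le md x : 0 <= x < 1 -> is_median P md ->
  (P `]x, +oo[%classic <= P `]-oo, x[%classic)%E -> md <= x.
Proof.
move=> /andP[x0 x1] [_ h] /half_le_itvNyc h2.
rewrite leNgt; apply/negP => xm.
by apply: (half_disjoint_itv xm _ h2 h); apply: rbeta_prob_itv_gt0; lra.
Qed.

Lemma median_ge md x : 0 < x <= 1 -> is_median P md ->
  (P `]-oo, x[%classic <= P `]x, +oo[%classic)%E -> x <= md.
Proof.
move=> /andP[x0 x1] [h _] /half_le_itvcy h2.
rewrite leNgt; apply/negP => xm.
by apply: (half_disjoint_itv xm _ h h2); apply: rbeta_prob_itv_gt0; lra.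
Qed.

End rbeta_median.

(** * Limits of real powers *)

Section powR_limits.
Context {R : realType}.
Implicit Types c x : R.

Lemma powR_cvg c x : 0 < x -> y `^ c @[y --> x] --> x `^ c.
Proof.
move=> x0; have : {for x, continuous (@powR R ^~ c)}; last by [].
apply: differentiable_continuous; apply/derivable1_diffP.
by apply: derivable_powR; rewrite in_itv/= andbT.
Qed.

Lemma powR_onem_cvg c x : x < 1 -> (1 - y) `^ c @[y --> x] --> (1 - x) `^ c.
Proof.
move=> x1.
apply: (@continuous_comp _ _ _ (fun y : R => 1 - y) (@powR R ^~ c)).
  by apply: cvgB; [exact: cvg_cst|exact: cvg_id].
by apply: powR_cvg; rewrite subr_gt0.
Qed.

Lemma powR_onem_cvg0 c : 0 < c -> (1 - x) `^ c @[x --> 1^'-] --> (0 : R).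
Proof.
move=> c0; apply/cvg_at_leftP => u [u1 ucvg].
have /cvg_at_rightP := powR_cvg0 c0.
move=> /(_ (fun n => 1 - u n)); apply; split.
  by move=> n; rewrite subr_gt0.
by rewrite -(subrr (1 : R)); apply: cvgB => //; exact: cvg_cst.
Qed.

End powR_limits.

(** * The mean, and its comparison with the median *)

Section rbeta_mean.
Context {R : realType} (a b : R) (a0 : 0 < a) (b0 : 0 < b).
Local Notation mu := (@lebesgue_measure R).
Local Notation p := (rbeta_pdf a b).
Local Notation P := (rbeta_prob a0 b0).
Let m := a / (a + b).

Lemma continuous_rbeta_pdf (x : R) : 0 < x < 1 -> {for x, continuous p}.
Proof.
move=> /[dup] x01 /andP[x0 x1]; rewrite /prop_for /continuous_at rbeta_pdf_in//.
suff h : rbeta_weight a b y / rbeta_fun a b @[y --> x] -->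
    rbeta_weight a b x / rbeta_fun a b.
  apply: cvg_trans h; apply: near_eq_cvg; near=> y; rewrite rbeta_pdf_in//.
  by apply/andP; split; near: y; [exact: lt_nbhsr|exact: lt_nbhsl].
apply: cvgM; last exact: cvg_cst.
by apply: cvgM; [exact: powR_cvg|exact: powR_onem_cvg].
Unshelve. all: by end_near. Qed.

(** An antiderivative of [p x * (m - x)] with limit 0 at both endpoints. Hence the absolute first
    moments about [m] of the two sides agree, both being [primitive m], and [m] is the mean. *)
Let primitive (x : R) : R := x `^ a * (1 - x) `^ b / (rbeta_fun a b * (a + b)).

Let ab0 : 0 < a + b. Proof. exact: addr_gt0. Qed.

Let m0 : 0 < m. Proof. exact: divr_gt0. Qed.

Let m1 : m < 1. Proof. by rewrite ltr_pdivrMr// mul1r ltrDl. Qed.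

Let is_derive_primitive (x : R) : 0 < x < 1 ->
  is_derive x 1 primitive (p x * (m - x)).
Proof.
move=> /[dup] x01 /andP[x0 x1].
have x1' : 0 < 1 - x by rewrite subr_gt0.
have d1 := is_derive1_powR a x0.
have d2 : is_derive x 1 (fun y : R => (1 - y) `^ b) (- (b * (1 - x) `^ (b - 1))).
  have d3 := is_derive1_powR b x1'.
  have d4 : is_derive x 1 (fun y : R => 1 - y) (- 1).
    by apply: is_derive_eq; ring.
  have := @is_derive1_comp R (@powR R ^~ b) (fun y : R => 1 - y) x _ _ d3 d4.
  by rewrite mulrN1.
rewrite /primitive; apply: is_derive_eq.
rewrite rbeta_pdf_in// /rbeta_weight /GRing.scale/=.
rewrite -(mulr_powRB1 (ltW x0) a0) -(mulr_powRB1 (ltW x1') b0) /m.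
by field; rewrite !gt_eqF ?rbeta_fun_gt0.
Qed.

Let primitive_cvg0 : primitive x @[x --> 0^'+] --> 0.
Proof.
rewrite [X in _ --> X](_ : 0 = 0 * (1 - 0) `^ b / (rbeta_fun a b * (a + b))); last first.
  by rewrite !mul0r.
apply: cvgM; last exact: cvg_cst.
apply: cvgM; first exact: (powR_cvg0 a0).
by apply: cvg_at_right_filter; exact: powR_onem_cvg.
Qed.

Let primitive_cvg1 : primitive x @[x --> 1^'-] --> 0.
Proof.
rewrite [X in _ --> X](_ : 0 = 1 `^ a * 0 / (rbeta_fun a b * (a + b))); last first.
  by rewrite mulr0 mul0r.
apply: cvgM; last exact: cvg_cst.
apply: cvgM.
  by apply: cvg_at_left_filter; exact: powR_cvg.
exact: powR_onem_cvg0.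
Qed.

Let continuous_primitive (x : R) : 0 < x < 1 -> {for x, continuous primitive}.
Proof.
move=> x01; apply: differentiable_continuous; apply/derivable1_diffP.
by have [] := is_derive_primitive x01.
Qed.

Let measurable_pdfM (g : R -> R) : measurable_fun setT g ->
  measurable_fun setT (fun x => p x * g x).
Proof. by move=> mg; apply: measurable_funM => //; exact: measurable_rbeta_pdf. Qed.

Let mB : measurable_fun setT (fun x : R => m - x).
Proof. exact: measurable_funB. Qed.

Let mB' : measurable_fun setT (fun x : R => x - m).
Proof. exact: measurable_funB. Qed.

Let m01 : 0 < m < 1. Proof. by rewrite m0 m1. Qed.

Let moment_left :
  (\int[mu]_(x in `]-oo, m[) (p x * (m - x))%:E = (primitive m)%:E)%E.
Proof.
have h : (\int[mu]_(x in `]0%R, m[) (p x * (m - x))%:E = (primitive m - 0)%:E)%E.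
  have dF x : 0 < x < m -> is_derive x 1 primitive (p x * (m - x)).
    by move=> /andP[x0 xm]; apply: is_derive_primitive; rewrite x0 (lt_trans xm m1).
  apply: (ge0_integral_itvoo_FTC m0 (measurable_pdfM mB) _ _ dF primitive_cvg0).
  - by move=> x /andP[? ?]; rewrite mulr_ge0 ?rbeta_pdf_ge0//; lra.
  - move=> x /andP[? xm]; apply: cvgM.
      by apply: continuous_rbeta_pdf; apply/andP; split => //; exact: lt_trans xm m1.
    by apply: cvgB; [exact: cvg_cst|exact: cvg_id].
  - by apply: cvg_at_left_filter; exact: continuous_primitive.
rewrite -[primitive m]subr0 -h; apply: eq_integral_subset.
- by apply: subset_itvr.
- move=> x /=; rewrite !in_itv/= => xm x0m.
  by rewrite rbeta_pdf_out ?mul0r// => /andP[x0 _]; apply: x0m; rewrite x0.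
Qed.

Let moment_right :
  (\int[mu]_(x in `]m, +oo[) (p x * (x - m))%:E = (primitive m)%:E)%E.
Proof.
have h : (\int[mu]_(x in `]m, 1%R[) (p x * (x - m))%:E =
    (- 0 - (- primitive m))%:E)%E.
  have dF x : m < x < 1 -> is_derive x 1 (fun y => - primitive y) (p x * (x - m)).
    move=> /andP[mx x1]; have d : is_derive x 1 primitive (p x * (m - x)).
      by apply: is_derive_primitive; rewrite (lt_trans m0 mx).
    by apply: is_derive_eq; ring.
  apply: (ge0_integral_itvoo_FTC m1 (measurable_pdfM mB') _ _ dF).
  - by move=> x /andP[? ?]; rewrite mulr_ge0 ?rbeta_pdf_ge0//; lra.
  - move=> x /andP[mx ?]; apply: cvgM.
      by apply: continuous_rbeta_pdf; apply/andP; split => //; exact: lt_trans m0 mx.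
    by apply: cvgB; [exact: cvg_id|exact: cvg_cst].
  - apply: cvgN; apply: cvg_at_right_filter; exact: continuous_primitive.
  - exact: cvgN.
rewrite (_ : primitive m = - 0 - (- primitive m)); last by rewrite oppr0 sub0r opprK.
rewrite -h; apply: eq_integral_subset.
- by apply: subset_itvl.
- move=> x /=; rewrite !in_itv/= andbT => xm x0m.
  by rewrite rbeta_pdf_out ?mul0r// => /andP[_ x1]; apply: x0m; rewrite xm x1.
Qed.

(** Integrates [x + max(m - x, 0) = m + max(x - m, 0)] against the density. All terms are
    nonnegative on the support, so additivity holds in the extended reals, and the two moments,
    equal and finite, cancel. *)
Let integral_mulr_pdf : (\int[mu]_x (p x * x)%:E = m%:E)%E.
Proof.
have px0 x : 0 <= p x * x.
  have [x0|x0] := leP 0 x; first by rewrite mulr_ge0 ?rbeta_pdf_ge0.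
  by rewrite rbeta_pdf_out ?mul0r// => /andP[]; lra.
have pmax0 x y : 0 <= p x * Num.max y 0.
  by rewrite mulr_ge0 ?rbeta_pdf_ge0// le_max lexx orbT.
have mmax (g : R -> R) : measurable_fun setT g ->
    measurable_fun setT (fun x => (p x * Num.max (g x) 0)%:E).
  move=> mg; apply/measurable_EFinP; apply: measurable_pdfM.
  exact: measurable_maxr.
have ml : (\int[mu]_x (p x * Num.max (m - x) 0)%:E = (primitive m)%:E)%E.
  rewrite -moment_left (@eq_integral_subset _ `]-oo, m[%classic)//=.
    apply: eq_integral => x; rewrite inE/= in_itv/= => xm.
    by rewrite (max_idPl _)// subr_ge0 ltW.
  move=> x _; rewrite in_itv/= => /negP; rewrite -leNgt => mx.
  by rewrite (max_idPr _) ?mulr0// subr_le0.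
have mr : (\int[mu]_x (p x * Num.max (x - m) 0)%:E = (primitive m)%:E)%E.
  rewrite -moment_right (@eq_integral_subset _ `]m, +oo[%classic)//=.
    apply: eq_integral => x; rewrite inE/= in_itv/= andbT => xm.
    by rewrite (max_idPl _)// subr_ge0 ltW.
  move=> x _; rewrite in_itv/= andbT => /negP; rewrite -leNgt => mx.
  by rewrite (max_idPr _) ?mulr0// subr_le0.
have : (\int[mu]_x ((p x * x)%:E + (p x * Num.max (m - x) 0)%:E) =
    \int[mu]_x (m%:E * (p x)%:E + (p x * Num.max (x - m) 0)%:E))%E.
  apply: eq_integral => x _; rewrite -EFinM -!EFinD; congr EFin.
  rewrite -mulrDr [m * _]mulrC -mulrDr; congr (_ * _).
  by rewrite /Num.max; case: ifPn; case: ifPn => *; lra.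
rewrite ge0_integralD//=; last 4 first.
- by move=> x _; rewrite lee_fin.
- by apply/measurable_EFinP; exact: measurable_pdfM.
- by move=> x _; rewrite lee_fin.
- exact: mmax.
rewrite ge0_integralD//=; last 4 first.
- by move=> x _; rewrite -EFinM lee_fin mulr_ge0 ?rbeta_pdf_ge0// ltW.
- by apply: measurable_funeM; apply/measurable_EFinP; exact: measurable_rbeta_pdf.
- by move=> x _; rewrite lee_fin.
- exact: mmax.
rewrite ge0_integralZl//=; last 3 first.
- by apply/measurable_EFinP; exact: measurable_rbeta_pdf.
- by move=> x _; rewrite lee_fin rbeta_pdf_ge0.
- by rewrite lee_fin ltW.
rewrite integral_rbeta_pdf// mule1 ml mr.
by case: (\int[mu]_x (p x * x)%:E)%E => [i| |]// [] /addIr ->.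
Qed.

(** The expectation is split into positive and negative parts so that [ge0_integral_density] applies
    to each; the negative part vanishes on the support of the density. *)
Lemma rbeta_expectation : ('E_P[idfun] = m%:E)%E.
Proof.
have mp := @measurable_rbeta_pdf R a b.
have p0 := @rbeta_pdf_ge0 R a b.
rewrite unlock integralE.
rewrite (@ge0_integral_density _ _ _ mu P p)//.
rewrite (@ge0_integral_density _ _ _ mu P p)//.
rewrite [X in (_ - X)%E]integral0_eq ?sube0; last first.
  move=> x _; rewrite funenegE.
  have [x0|x0] := leP x 0.
    by rewrite rbeta_pdf_out ?mule0// => /andP[]; lra.
  by rewrite (max_idPr _) ?mul0e// lee_fin oppr_le0 ltW.
rewrite -integral_mulr_pdf; apply: eq_integral => x _; rewrite funeposE.
have [x0|x0] := leP x 0.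
  by rewrite rbeta_pdf_out ?mule0 ?mul0r// => /andP[]; lra.
by rewrite (max_idPl _) ?lee_fin ?ltW//= -EFinM mulrC.
- by apply: measurable_funeneg; apply/measurable_EFinP; exact: measurable_id.
- by apply: measurable_funepos; apply/measurable_EFinP; exact: measurable_id.
Qed.

Lemma median_mean md : a <= b -> is_median P md -> (md%:E <= 'E_P[idfun])%E.
Proof.
move=> ab med; rewrite rbeta_expectation lee_fin.
have [t0 /andP[t00 t0m] [lo hi]] := log_ratio_crossing a0 ab.
rewrite -/m in t0m lo hi.
have m2 : m <= 1 / 2 by rewrite /m ler_pdivrMr//; lra.
have mp := @measurable_rbeta_pdf R a b.
have p0 := @rbeta_pdf_ge0 R a b.
pose S x : R := m - 1 * (x - m).
have mpS : measurable_fun setT (fun x => p (S x)).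
  apply: (@measurableT_comp _ _ _ _ _ _ p) => //.
  by apply: measurable_funB => //; exact: measurable_funM.
apply: (median_le _ med); first by rewrite (ltW m0) m1.
rewrite !rbeta_probE (@integral_itvNyo_reflection _ m 1)//.
(* Expanded form of [0 <= (x - m - t0) * (p x - p (S x))], arranged so that both sides are sums of
   nonnegative functions. *)
have key x : m < x ->
    p x * t0 + p (S x) * (x - m) <= p x * (x - m) + p (S x) * t0.
  move=> mx.
  suff : 0 <= (x - m - t0) * (p x - p (S x)) by lra.
  (* A reflected point outside the support has density 0 and forces [x - m >= m >= t0]. *)
  have [S0|S0] := leP (S x) 0.
    rewrite (@rbeta_pdf_out _ _ _ (S x)); last by move=> /andP[]; lra.
    by rewrite subr0 mulr_ge0 ?p0//; move: S0; rewrite /S; lra.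
  have x1 : 0 < x < 1 by move: S0; rewrite /S => ?; apply/andP; split; lra.
  have S1 : 0 < S x < 1 by apply/andP; split => //; rewrite /S; lra.
  have E1 : m + (x - m) = x by ring.
  have E2 : m - (x - m) = S x by rewrite /S mul1r.
  have [xt|xt|->] := ltgtP (x - m) t0; last by rewrite subrr mul0r.
    have := lo (x - m) ltac:(apply/andP; split; lra).
    rewrite /log_ratio -/m E1 E2 subr_le0 -rbeta_pdf_le// => ?.
    by rewrite mulr_le0// subr_le0// ltW.
  have := hi (x - m) ltac:(move: S0; rewrite /S => ?; apply/andP; split; rewrite -/m; lra).
  rewrite /log_ratio -/m E1 E2 subr_ge0 -rbeta_pdf_le// => ?.
  by rewrite mulr_ge0// subr_ge0// ltW.
have mS (g : R -> R) : measurable_fun setT g ->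
    measurable_fun (`]m, +oo[ : set R) (fun x => (p (S x) * g x)%:E).
  by move=> mg; apply: measurable_funTS; apply/measurable_EFinP; exact: measurable_funM.
have mp' (g : R -> R) : measurable_fun setT g ->
    measurable_fun (`]m, +oo[ : set R) (fun x => (p x * g x)%:E).
  by move=> mg; apply: measurable_funTS; apply/measurable_EFinP; exact: measurable_funM.
have ge0 x (c : R) : 0 <= c -> (0 <= (p x * c)%:E)%E.
  by move=> c0; rewrite lee_fin mulr_ge0.
have left : (\int[mu]_(x in `]m, +oo[) (p (S x) * (x - m))%:E = (primitive m)%:E)%E.
  rewrite -moment_left.
  (* The truncation at 0 changes nothing left of [m] and makes the integrand nonnegative on the
     whole line, as the folding lemma requires. *)
  transitivity (\int[mu]_(x in `]-oo, m[) (p x * Num.max (m - x) 0)%:E)%E.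
    rewrite (@integral_itvNyo_reflection _ m 1 (fun x => p x * Num.max (m - x) 0))//.
    - apply: eq_integral => x; rewrite inE/= in_itv/= andbT => mx.
      rewrite -/(S x) mul1r (max_idPl _); last by rewrite /S; lra.
      by congr (_ * _)%:E; rewrite /S; ring.
    - apply: measurable_funM => //; exact: measurable_maxr.
    - by move=> x; rewrite mulr_ge0// le_max lexx orbT.
  apply: eq_integral => x; rewrite inE/= in_itv/= => xm.
  by rewrite (max_idPl _)// subr_ge0 ltW.
have : (\int[mu]_(x in `]m, +oo[) ((p x * t0)%:E + (p (S x) * (x - m))%:E) <=
    \int[mu]_(x in `]m, +oo[) ((p x * (x - m))%:E + (p (S x) * t0)%:E))%E.
  apply: ge0_le_integral => //=.
  - move=> x; rewrite in_itv/= andbT => mx.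
    by rewrite adde_ge0// ge0// ?subr_ge0 ltW.
  - by apply: emeasurable_funD; [exact: mp'|exact: mS].
  - by apply: emeasurable_funD; [exact: mp'|exact: mS].
  - move=> x; rewrite in_itv/= andbT => mx; rewrite -!EFinD lee_fin.
    exact: key.
rewrite ge0_integralD//=; last 4 first.
- by move=> x _; rewrite ge0// ltW.
- exact: mp'.
- by move=> x; rewrite in_itv/= andbT => mx; rewrite ge0// subr_ge0 ltW.
- exact: mS.
rewrite ge0_integralD//=; last 4 first.
- by move=> x; rewrite in_itv/= andbT => mx; rewrite ge0// subr_ge0 ltW.
- exact: mp'.
- by move=> x _; rewrite ge0// ltW.
- exact: mS.
(* The first moments cancel, being equal and finite; the common factor [t0 > 0] is then divided
   out. *)
rewrite left moment_right addeC leeD2lE//.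
under eq_integral do rewrite EFinM.
under [leRHS]eq_integral do rewrite EFinM.
rewrite !ge0_integralZr//=.
- rewrite lee_pmul2r ?lte_fin//.
  by under [X in _ -> (_ <= X)%E]eq_integral do rewrite mul1r -/(S _).
- by apply: measurable_funTS; exact/measurable_EFinP.
- by move=> x _; rewrite lee_fin.
- by rewrite lee_fin ltW.
- by apply: measurable_funTS; exact/measurable_EFinP.
- by move=> x _; rewrite lee_fin.
- by rewrite lee_fin ltW.
Qed.

End rbeta_mean.

(** * Modes and anti-modes, and their comparison with the median *)

Section rbeta_modes.
Context {R : realType} (a b : R) (a0 : 0 < a) (b0 : 0 < b).
Local Notation mu := (@lebesgue_measure R).
Local Notation p := (rbeta_pdf a b).
Local Notation P := (rbeta_prob a0 b0).
Local Notation psi := (log_weight (a - 1) (b - 1)).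

Lemma cext_rbeta_pdf (x : R) : 0 < x < 1 -> cext_dom p x /\ cext p x = p x.
Proof.
move=> x01; have E : within `]0, 1[ (nbhs x) = nbhs x.
  by apply: within_interior; apply: near_in_itvoo; rewrite in_itv.
have cp : p y @[y --> x] --> p x by exact: continuous_rbeta_pdf.
split; last by rewrite /cext E; exact/cvg_lim.
by split; [case/andP: x01 => *; rewrite !ltW|rewrite E; apply/cvg_ex; exists (p x)].
Qed.

(** Clearing denominators gives [(a - 1) * (1 - x) = (b - 1) * x]. The conclusion has the shape in
    which [log_ratio_mode] and [log_weight_antimode] take their exponents. *)
Lemma is_derive_log_weight0 (x : R) : 0 < x < 1 -> is_derive x 1 psi 0 ->
  a - 1 = (a + b - 2) * x /\ b - 1 = (a + b - 2) * (1 - x).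
Proof.
move=> /[dup] x01 /andP[x0 x1] [_ d0].
have [_] := is_derive_log_weight (a - 1) (b - 1) x01.
rewrite d0 => h.
have e : (a - 1) * (1 - x) - (b - 1) * x = 0.
  rewrite -[RHS](mulr0 (x * (1 - x))) h.
  by field; rewrite !gt_eqF// subr_gt0.
by split; lra.
Qed.

Let dpsi (t : R) : t \in `]0, 1[%R -> derivable psi t 1.
Proof.
rewrite in_itv/= => t01.
by have [] := is_derive_log_weight (a - 1) (b - 1) t01.
Qed.

Lemma is_mode_interior mo : is_mode p mo -> 0 < mo < 1 ->
  a - 1 = (a + b - 2) * mo /\ b - 1 = (a + b - 2) * (1 - mo).
Proof.
move=> [_ h] mo01; apply: is_derive_log_weight0 => //.
apply: (derive1_at_max (ler01) dpsi); rewrite ?in_itv// => t /[!in_itv]/= t01.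
rewrite -rbeta_pdf_le//.
have [td <-] := cext_rbeta_pdf t01; have [_ <-] := cext_rbeta_pdf mo01.
exact: h.
Qed.

Lemma is_antimode_interior am : is_antimode p am -> 0 < am < 1 ->
  a - 1 = (a + b - 2) * am /\ b - 1 = (a + b - 2) * (1 - am).
Proof.
move=> [_ h] am01; apply: is_derive_log_weight0 => //.
apply: (derive1_at_min (ler01) dpsi); rewrite ?in_itv// => t /[!in_itv]/= t01.
rewrite -rbeta_pdf_le//.
have [td <-] := cext_rbeta_pdf t01; have [_ <-] := cext_rbeta_pdf am01.
exact: h.
Qed.

Let near_rbeta_pdf (F : set_system R) (l : R) : Filter F ->
  (\forall y \near F, 0 < y < 1) ->
  rbeta_weight a b y / rbeta_fun a b @[y --> F] --> l -> p y @[y --> F] --> l.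
Proof.
move=> FF F01; apply: cvg_trans; apply: near_eq_cvg.
by apply: filterS F01 => y y01; rewrite rbeta_pdf_in.
Qed.

(** The density tends to 0 at 1 but is positive at 1/2. *)
Lemma rbeta_mode_neq1 : 1 <= a -> 1 < b -> ~ is_mode p 1.
Proof.
move=> a1 b1 [[_ pL] h].
have pL' : p y @[y --> 1^'-] --> cext p 1.
  move=> A /pL hA; have h0 : \forall y \near (1 : R), 0 < y by exact: lt_nbhsr.
  change (\forall y \near (1 : R), y < 1 -> A (p y)).
  have {}hA : \forall y \near (1 : R), y \in `]0, 1[%R -> A (p y) by exact: hA.
  by apply: filterS2 hA h0 => y hy y0 y1; apply: hy; rewrite in_itv/= y0.
have p0 : p y @[y --> 1^'-] --> 0.
  apply: near_rbeta_pdf.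
    by near=> y; apply/andP; split; near: y; [exact: nbhs_left_gt|exact: nbhs_left_lt].
  rewrite [X in _ --> X](_ : 0 = 1 `^ (a - 1) * 0 / rbeta_fun a b); last first.
    by rewrite mulr0 mul0r.
  apply: cvgM; last exact: cvg_cst.
  rewrite /rbeta_weight; apply: cvgM.
    by apply: cvg_at_left_filter; exact: powR_cvg.
  by apply: powR_onem_cvg0; rewrite subr_gt0.
have h2 : 0 < (1 / 2 : R) < 1 by lra.
have [d e] := cext_rbeta_pdf h2.
have := h _ d; rewrite e (cvg_unique _ pL' p0).
by rewrite rbeta_pdf_in// leNgt rbeta_weight_expR// divr_gt0 ?expR_gt0 ?rbeta_fun_gt0.
Unshelve. all: by end_near. Qed.

(** The density has no finite limit at 0: such a limit times [y ^ (1 - a)] would give 0, whereas the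
    product tends to the positive number [1 / B(a, b)]. So 0 is outside [cext_dom p]. *)
Lemma rbeta_antimode_neq0 : a < 1 -> ~ is_antimode p 0.
Proof.
move=> a1 [[_ pL] _].
have pL' : p y @[y --> 0^'+] --> cext p 0.
  move=> A /pL hA; have h1 : \forall y \near (0 : R), y < 1 by exact: lt_nbhsl.
  change (\forall y \near (0 : R), 0 < y -> A (p y)).
  have {}hA : \forall y \near (0 : R), y \in `]0, 1[%R -> A (p y) by exact: hA.
  by apply: filterS2 hA h1 => y hy y1 y0; apply: hy; rewrite in_itv/= y0.
have h1 : y `^ (1 - a) * p y @[y --> 0^'+] --> 0 * cext p 0.
  by apply: cvgM => //; apply: powR_cvg0; rewrite subr_gt0.
have h2 : y `^ (1 - a) * p y @[y --> 0^'+] --> (1 - 0) `^ (b - 1) / rbeta_fun a b.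
  apply: (@cvg_trans _ ((1 - y) `^ (b - 1) / rbeta_fun a b @[y --> 0^'+])).
    apply: near_eq_cvg; near=> y.
    have y0 : 0 < y by near: y; exact: nbhs_right_gt.
    have y1 : y < 1 by near: y; exact: nbhs_right_lt.
    rewrite rbeta_pdf_in ?y0// /rbeta_weight !mulrA -powRD; last first.
      by apply/implyP => _; rewrite gt_eqF.
    by rewrite (_ : 1 - a + (a - 1) = 0) ?powRr0 ?mul1r//; ring.
  apply: cvgM; last exact: cvg_cst.
  by apply: cvg_at_right_filter; exact: powR_onem_cvg.
have e : 0 * cext p 0 = (1 - 0) `^ (b - 1) / rbeta_fun a b.
  exact: cvg_unique h1 h2.
suff : 0 < (1 - 0) `^ (b - 1) / rbeta_fun a b by rewrite -e mul0r ltxx.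
by rewrite divr_gt0 ?rbeta_fun_gt0// powR_gt0// subr0.
Unshelve. all: by end_near. Qed.

(** A mode at 0 lies below every median and a mode at 1 is excluded, so the reflection argument is
    left with an interior mode. *)
Lemma mode_median mo md : 1 <= a <= b -> (a, b) <> (1, 1) ->
  is_mode p mo -> is_median P md -> mo <= md.
Proof.
move=> /andP[a1 ab] ne1 mod_mo med.
have b1 : 1 < b.
  rewrite lt_neqAle (le_trans a1 ab) andbT; apply/eqP => b1.
  by apply: ne1; congr pair; lra.
have [/andP[mo0 mo1] _] := mod_mo.1.
move: mo0; rewrite le_eqVlt => /predU1P[<-|mo0]; first exact: is_median_ge0 med.
move: mo1; rewrite le_eqVlt => /predU1P[mo1|mo1].
  by move: mod_mo; rewrite mo1 => /(rbeta_mode_neq1 a1 b1).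
have mo01 : 0 < mo < 1 by rewrite mo0.
have [am bm] := is_mode_interior mod_mo mo01.
have k0 : 0 < a + b - 2 by lra.
(* [a <= b] reads [k * mo <= k * (1 - mo)] with [k = a + b - 2 > 0]. *)
have mo2 : mo <= 1 / 2.
  by rewrite -(ler_pM2l k0); lra.
apply: (median_ge _ med); first by rewrite mo0 ltW.
have mp := @measurable_rbeta_pdf R a b.
rewrite !rbeta_probE (@integral_itvNyo_reflection _ mo 1)//; last first.
  by move=> y; exact: rbeta_pdf_ge0.
apply: ge0_le_integral => //=.
- by move=> x _; rewrite lee_fin mul1r rbeta_pdf_ge0.
- apply: measurable_funTS; apply/measurable_EFinP.
  apply: measurable_funM => //; apply: (@measurableT_comp _ _ _ _ _ _ p) => //.
  by apply: measurable_funB => //; apply: measurable_funM => //; exact: measurable_funB.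
- by apply: measurable_funTS; exact/measurable_EFinP.
move=> x; rewrite in_itv/= andbT => mx; rewrite lee_fin !mul1r.
have [S0|S0] := leP (mo - (x - mo)) 0.
  rewrite rbeta_pdf_out ?rbeta_pdf_ge0// => /andP[]; lra.
rewrite rbeta_pdf_le//; try by apply/andP; split; lra.
rewrite -subr_ge0 am bm -[X in _ <= log_weight _ _ X - _](subrKC mo).
by apply: log_ratio_mode => //; [exact: ltW|apply/andP; split; lra].
Qed.

Lemma median_antimode am md : a <= b <= 1 -> (a, b) <> (1, 1) ->
  is_antimode p am -> is_median P md -> md <= am.
Proof.
move=> /andP[ab b1] ne1 mod_am med.
have a1 : a < 1.
  rewrite lt_neqAle (le_trans ab b1) andbT; apply/eqP => a1.
  by apply: ne1; congr pair; lra.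
have [/andP[am0 am1] _] := mod_am.1.
move: am1; rewrite le_eqVlt => /predU1P[->|am1]; first exact: is_median_le1 med.
move: am0; rewrite le_eqVlt => /predU1P[am0|am0].
  by move: mod_am; rewrite -am0 => /(rbeta_antimode_neq0 a1).
have am01 : 0 < am < 1 by rewrite am0.
have [Am Bm] := is_antimode_interior mod_am am01.
have k0 : a + b - 2 < 0 by lra.
(* Here [k = a + b - 2] is negative, so [a <= b] puts the anti-mode in the right half. *)
have am2 : 1 / 2 <= am.
  by rewrite -(ler_nM2l k0); lra.
have N0 : 0 < 1 - am by lra.
(* The stretch factor of the decreasing affine map that fixes [am] and sends 1 to 0. *)
pose r := am / (1 - am).
have r1 : 1 <= r by rewrite ler_pdivlMr//; lra.
have r0 : 0 < r by exact: lt_le_trans r1.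
apply: (median_le _ med); first by rewrite am1 ltW.
have mp := @measurable_rbeta_pdf R a b.
rewrite !rbeta_probE (@integral_itvNyo_reflection _ am r)//; last first.
  by move=> y; exact: rbeta_pdf_ge0.
apply: ge0_le_integral => //=.
- by move=> x _; rewrite lee_fin rbeta_pdf_ge0.
- by apply: measurable_funTS; exact/measurable_EFinP.
- apply: measurable_funTS; apply/measurable_EFinP.
  apply: measurable_funM => //; apply: (@measurableT_comp _ _ _ _ _ _ p) => //.
  by apply: measurable_funB => //; apply: measurable_funM => //; exact: measurable_funB.
move=> x; rewrite in_itv/= andbT => mx; rewrite lee_fin.
have [x1|x1] := leP 1 x.
  rewrite rbeta_pdf_out; first by rewrite mulr_ge0 ?rbeta_pdf_ge0// ltW.
  by move=> /andP[]; lra.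
(* The relative position of [x] between [am] and 1; its image under the map is [am - am * u]. *)
pose u := (x - am) / (1 - am).
have u01 : 0 < u < 1.
  by rewrite divr_gt0 ?subr_gt0//= ltr_pdivrMr//; lra.
have xE : x = am + (1 - am) * u by rewrite /u mulrC divfK ?gt_eqF// subrKC.
have SE : am - r * (x - am) = am - am * u by rewrite /r /u; field; rewrite gt_eqF.
have S0 : 0 < am - am * u < 1.
  case/andP: u01 => u0 u1.
  have : 0 < am * u by exact: mulr_gt0.
  have : am * u < am by rewrite gtr_pMr.
  by move=> *; apply/andP; split; lra.
(* The Jacobian factor [r >= 1] only helps, so comparing densities suffices. *)
rewrite SE; apply: (@le_trans _ _ (p (am - am * u))); last first.
  by rewrite ler_peMl ?rbeta_pdf_ge0.
rewrite rbeta_pdf_le//; last by apply/andP; split; lra.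
rewrite [in leLHS]xE Am Bm; apply: log_weight_antimode => //; first exact: ltW.
by rewrite am2.
Qed.

End rbeta_modes.

Theorem corollary13 (R : realType) (a b : R) (a0 : 0 < a) (b0 : 0 < b) :
  (1 <= a <= b -> (a, b) <> (1, 1) ->
     forall mo md : R,
       is_mode (rbeta_pdf a b) mo -> is_median (rbeta_prob a0 b0) md ->
       mo <= md /\ (md%:E <= 'E_(rbeta_prob a0 b0)[idfun])%E) /\
  (a <= b <= 1 ->
     forall md : R, is_median (rbeta_prob a0 b0) md ->
       (md%:E <= 'E_(rbeta_prob a0 b0)[idfun])%E /\
       ((a, b) <> (1, 1) ->
          forall am : R, is_antimode (rbeta_pdf a b) am -> md <= am)).
Proof.
split=> [/[dup] ab /andP[_ ab'] ne1 mo md mod med|/[dup] ab /andP[ab' _] md med].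
  by split; [exact: mode_median med|exact: median_mean].
by split=> [|ne1 am mod]; [exact: median_mean|exact: median_antimode med].
Qed.
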